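(* For every integer $m\ge 0$ there exists a collection of points $\mathcal{P}\subset[0,1)^2$ such that $$ \operatorname{dist}_{\mathbb{H}}(p,q)\ge 2^{-m}\quad\text{for all } p\ne q \text{ in }\mathcal{P}, $$ and $$ \#(\mathcal{P})=2^{2m+1}. $$
   Context: A dyadic interval is an interval $[j2^n,(j+1)2^n)$ with $j,n\in\mathbb{Z}$; a dyadic rectangle is a product of two dyadic intervals (of possibly different lengths). For $p,q\in[0,1)^2$, $$\operatorname{dist}_{\mathbb{H}}(p,q)=\inf\{|R|^{1/2}: R \text{ is a dyadic rectangle containing } p \text{ and } q\},$$ where $|R|$ is the area of $R$. (This is not a metric.) *)

(* Defs.v *)
From HB Require Import structures.
From mathcomp Require Import all_boot all_order all_algebra.
From mathcomp Require Import all_classical all_reals all_analysis.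

Set Implicit Arguments.
Unset Strict Implicit.
Unset Printing Implicit Defensive.

Import Order.TTheory GRing.Theory Num.Theory.
Import numFieldNormedType.Exports.

Local Open Scope classical_set_scope.
Local Open Scope ring_scope.

Definition dyadic_interval (R : realType) (I : set R) : Prop :=
  exists j n : int, I = `[j%:~R * 2 ^ n, (j + 1)%:~R * 2 ^ n[%classic.

Definition dyadic_rectangle (R : realType) (Q : set (R * R)) : Prop :=
  exists I J : set R,
    [/\ dyadic_interval I, dyadic_interval J & Q = I `*` J].

Definition area (R : realType) (Q : set (R * R)) : \bar R :=
  (@lebesgue_measure R \x @lebesgue_measure R)%E Q.

Definition unit_square (R : realType) : set (R * R) :=
  `[0, 1[%classic `*` `[0, 1[%classic.

(* Only meant for p and q in the unit square: the set of values is then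
   bounded below by 0 and, the unit square being itself a dyadic rectangle,
   nonempty, so that [inf] is a genuine infimum. *)
Definition dist_H (R : realType) (p q : R * R) : R :=
  inf [set Num.sqrt (fine (area Q)) |
       Q in [set Q : set (R * R) | [/\ dyadic_rectangle Q, Q p & Q q]]].

(* Main.v *)
(** The point set is the Hammersley net: with [N = 2m + 1], take the points
    [(k / 2^N, rev k / 2^N)] for [k < 2^N], where [rev] reverses the [N] binary
    digits.  A dyadic rectangle of sides [2^-a] and [2^-b] determines the [a]
    leading digits of the abscissa index [k] and, by reversal, its [b] trailing
    digits.  So two distinct points can only share it if [a + b < N], that is,
    if its area is at least [2^-(2m)]. *)
Require Import Defs.
From HB Require Import structures.
From mathcomp Require Import all_boot all_order all_algebra.
From mathcomp Require Import all_classical all_reals all_analysis.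
From mathcomp Require Import zify lra.

Import Order.TTheory GRing.Theory Num.Theory.
Import numFieldNormedType.Exports.

Set Implicit Arguments.
Unset Strict Implicit.
Unset Printing Implicit Defensive.

(** Only the [n] lowest digits of [k] are read; the lowest becomes the leading digit of the
    result. *)
Fixpoint bit_rev (n k : nat) : nat :=
  if n is n'.+1 then (odd k * 2 ^ n' + bit_rev n' k./2)%N else 0%N.

Lemma bit_rev_lt (n k : nat) : (bit_rev n k < 2 ^ n)%N.
Proof.
elim: n k => [//|n IHn] k /=; rewrite expnS mul2n -addnn.
by case: (odd k); rewrite ?mul1n ?mul0n ?ltn_add2l ?add0n ?(ltn_addr _ (IHn _)) ?IHn.
Qed.

Lemma bit_rev_div_odd (n a k : nat) :
  (a <= n)%N -> bit_rev n.+1 k %/ 2 ^ a =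
                (odd k * 2 ^ (n - a) + bit_rev n k./2 %/ 2 ^ a)%N.
Proof.
move=> an /=; rewrite -{1}(subnK an) expnD mulnA divnMDl ?expn_gt0//.
Qed.

(** The quotient of [k] fixes all its digits from position [b] up, and the quotient of the reversal
    fixes the [b] lowest ones, so nothing is left free. The induction peels off the lowest digit,
    which leads the reversal; at [b = 0] the first quotient is [k] itself. *)
Lemma bit_rev_inj_digits (n a b k l : nat) : (a + b = n)%N ->
  k %/ 2 ^ b = l %/ 2 ^ b ->
  bit_rev n k %/ 2 ^ a = bit_rev n l %/ 2 ^ a -> k = l.
Proof.
elim: n b k l => [|n IHn] [|b] k l; rewrite ?expn0 ?divn1 //.
  by rewrite addnS.
rewrite addnS => -[abn]; rewrite expnS !divnMA !divn2 => kl.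
have an : (a <= n)%N by rewrite -abn leq_addr.
rewrite !bit_rev_div_odd// => revkl.
(* The remaining digits stay below the weight [2 ^ (n - a)] of the leading one, so dividing by that
   weight isolates the parity. *)
have low i : (bit_rev n i./2 %/ 2 ^ a < 2 ^ (n - a))%N.
  by rewrite ltn_divLR ?expn_gt0// -expnD subnK// bit_rev_lt.
have oddE : odd k = odd l :> nat.
  move/(congr1 (fun x => x %/ 2 ^ (n - a))%N): revkl.
  by rewrite !divnMDl ?expn_gt0// !(divn_small (low _)) !addn0.
move: revkl; rewrite oddE => /addnI /(IHn _ _ _ abn kl) halfE.
by rewrite -(odd_double_half k) -(odd_double_half l) oddE halfE.
Qed.

Local Open Scope classical_set_scope.
Local Open Scope ring_scope.

Section HammersleyNet.
Context {R : realType}.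

(** Scaling by [2 ^+ N] turns the two points into integers and the interval into one of length
    [2 ^ (N + n)]. *)
Lemma dyadic_common_digits (N b k l : nat) (j n : int) :
  N%:Z + n <= b%:Z ->
  `[j%:~R * 2 ^ n, (j + 1)%:~R * 2 ^ n[%classic (k%:R / 2 ^+ N : R) ->
  `[j%:~R * 2 ^ n, (j + 1)%:~R * 2 ^ n[%classic (l%:R / 2 ^+ N : R) ->
  (k %/ 2 ^ b = l %/ 2 ^ b)%N.
Proof.
move=> Nnb; rewrite /= !in_itv /=.
have N0 : (0 : R) < 2 ^+ N by rewrite exprn_gt0.
have scaleE (x : R) : x * 2 ^ n * 2 ^+ N = x * 2 ^ (N%:Z + n).
  by rewrite -mulrA exprnP -expfzDr ?pnatr_eq0// addrC.
rewrite !ler_pdivlMr// !ltr_pdivrMr// !scaleE.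
move: Nnb; case: (N%:Z + n) => c.
  rewrite -exprnP lez_nat => cb.
  (* When the scaled length is [2 ^ c] with [c] natural, [j] is the common quotient by [2 ^ c],
     hence the quotients by the coarser [2 ^ b] agree too. *)
  have digit (i : nat) : j%:~R * 2 ^+ c <= (i%:R : R) < (j + 1)%:~R * 2 ^+ c ->
      (i %/ 2 ^ c)%N%:Z = j.
    have -> : (2 ^+ c : R) = (2 ^ c)%N%:Z%:~R by rewrite -pmulrn natrX.
    rewrite (pmulrn 1 i) -!intrM ler_int ltr_int => ji.
    have c0 : (0 < 2 ^ c)%N by rewrite expn_gt0.
    have := divn_eq i (2 ^ c); have := ltn_pmod i c0; nia.
  move=> /digit kj /digit lj.
  have /eqP := etrans kj (esym lj); rewrite eqz_nat => /eqP kl.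
  by rewrite -(subnKC cb) expnD !divnMA kl.
(* Here the scaled interval is half-open of length at most 1, so it holds at most one integer and
   [k = l]. *)
move=> _ kj lj; congr (_ %/ _)%N.
have le1 : (2 : R) ^ Negz c <= 1.
  by rewrite NegzE -exprnN invf_le1 ?exprn_gt0// exprn_ege1 ?ler1n.
have e : (j + 1)%:~R = j%:~R + 1 :> R by rewrite intrD.
rewrite e mulrDl mul1r in kj lj.
move: kj lj => /andP[k1 k2] /andP[l1 l2].
have kl1 : k%:R < l%:R + 1 :> R by lra.
have lk1 : l%:R < k%:R + 1 :> R by lra.
move: kl1 lk1; rewrite !natr1 !ltr_nat; lia.
Qed.

Lemma area_dyadic_rectangle (i j n p : int) :
  area (`[i%:~R * 2 ^ n, (i + 1)%:~R * 2 ^ n[%classic `*`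
        `[j%:~R * 2 ^ p, (j + 1)%:~R * 2 ^ p[%classic : set (R * R)) =
  (2 ^ (n + p))%:E.
Proof.
have len (k q : int) : lebesgue_measure
    (`[k%:~R * 2 ^ q, (k + 1)%:~R * 2 ^ q[%classic : set R) = (2 ^ q)%:E.
  rewrite lebesgue_measure_itv /= lte_fin ltr_pM2r ?exprz_gt0//.
  by rewrite ltr_int ltrDl ltr01 -EFinB -mulrBl intrD addrAC subrr add0r mul1r.
rewrite /area product_measure1E//.
by apply: etrans (congr2 mule (len i n) (len j p)) _; rewrite -EFinM -expfzDr ?pnatr_eq0.
Qed.

Definition hammersley (N k : nat) : R * R :=
  (k%:R / 2 ^+ N, (bit_rev N k)%:R / 2 ^+ N).

Lemma hammersley_unit_square (N k : nat) :
  (k < 2 ^ N)%N -> unit_square (hammersley N k).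
Proof.
have unitI (i : nat) : (i < 2 ^ N)%N -> 0 <= (i%:R / 2 ^+ N : R) < 1.
  move=> iN; rewrite divr_ge0 ?exprn_ge0//=.
  by rewrite ltr_pdivrMr ?exprn_gt0// mul1r -natrX ltr_nat.
by move=> kN; split; rewrite /= in_itv /= unitI// bit_rev_lt.
Qed.

Lemma hammersley_inj (N : nat) : injective (hammersley N).
Proof.
move=> k l [/(mulIf _) kl _]; apply/eqP; rewrite -(eqr_nat R); apply/eqP/kl.
by rewrite invr_eq0 expf_neq0.
Qed.

Lemma hammersley_rectangle (N k l : nat) (i j n p : int) :
  (k < 2 ^ N)%N -> (l < 2 ^ N)%N -> k <> l ->
  (`[i%:~R * 2 ^ n, (i + 1)%:~R * 2 ^ n[%classic `*`
   `[j%:~R * 2 ^ p, (j + 1)%:~R * 2 ^ p[%classic) (hammersley N k) ->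
  (`[i%:~R * 2 ^ n, (i + 1)%:~R * 2 ^ n[%classic `*`
   `[j%:~R * 2 ^ p, (j + 1)%:~R * 2 ^ p[%classic) (hammersley N l) ->
  - N%:Z < n + p.
Proof.
move=> kN lN kl [xk yk] [xl yl]; rewrite ltNge; apply/negP => npN; apply: kl.
(* Width at most [2 ^ -N]: the abscissa alone determines the index. *)
have [n0|n0] := lerP (N%:Z + n) 0.
  by have := dyadic_common_digits (b := 0%N) n0 xk xl; rewrite expn0 !divn1.
(* Width at least 1 forces height at most [2 ^ -N]: the ordinate fixes the whole reversal, while the
   quotients by [2 ^ N] both vanish. *)
have [n1|n1] := lerP 0 n.
  apply: (bit_rev_inj_digits (add0n N)); first by rewrite !divn_small.
  by apply: dyadic_common_digits yk yl; lia.
(* Now [- N < n < 0]: the abscissa fixes the [- n] leading digits, and [N + p <= - n] lets the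
   ordinate fix the other [N + n]. *)
apply: (@bit_rev_inj_digits N `|n| `|N%:Z + n|); first by lia.
  by apply: dyadic_common_digits xk xl; lia.
by apply: dyadic_common_digits yk yl; lia.
Qed.

End HammersleyNet.

Theorem theorem2p1 (R : realType) (m : nat) :
  exists P : set (R * R),
    [/\ P `<=` @unit_square R,
        forall p q : R * R, P p -> P q -> p <> q -> 2 ^- m <= dist_H p q
      & (P #= `I_(2 ^ (2 * m + 1)))%card].
Proof.
set N := (2 * m + 1)%N.
exists (hammersley N @` `I_(2 ^ N)); split.
- by move=> _ [k kN <-]; exact: hammersley_unit_square.
- move=> _ _ [k kN <-] [l lN <-] kl; apply: lb_le_inf.
    (* [lb_le_inf] asks for a nonempty set of values; the unit square provides one. *)
    exists (Num.sqrt (fine (area (@unit_square R)))), (@unit_square R) => //.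
    split; [|exact: hammersley_unit_square..].
    have unitI : dyadic_interval (`[0, 1[%classic : set R).
      by exists 0, 0; rewrite add0r expr0z mul0r mul1r.
    by exists `[0, 1[%classic, `[0, 1[%classic.
  move=> _ [Q [[_ [_ [[i [n ->]] [j [p ->]] ->]]] Qk Ql] <-].
  rewrite area_dyadic_rectangle /=.
  (* The exponents are integers, so the strict bound by [- N] improves to [- N + 1 = - 2m], whose
     square root is exactly [2 ^- m]. *)
  have np : - (2 * m)%N%:Z <= n + p.
    have : - N%:Z < n + p.
      by apply: (hammersley_rectangle kN lN _ Qk Ql) => kl'; apply: kl; rewrite kl'.
    by rewrite /N; lia.
  have -> : 2 ^- m = Num.sqrt (2 ^ (- (2 * m)%N%:Z)) :> R.
    rewrite -exprnN mulnC exprM -[in RHS]exprVn sqrtr_sqr.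
    by rewrite ger0_norm ?invr_ge0 ?exprn_ge0.
  rewrite ler_sqrt ?exprz_ge0//.
  by rewrite ler_weXz2l// ler1n.
- by apply: inj_card_eq; move=> k l _ _; exact: hammersley_inj.
Qed.
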